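(* Let $C$ be a finite skew brace with additive group $A=(C,+)$ and multiplicative group $R=(C,\circ)$, let $T$ be a non-trivial finite abelian group, let $\chi:R\to T$ be a surjective group homomorphism, and let $\Omega$ be the underlying set of $T$. Let $W=R^\Omega\rtimes T$ be the permutational wreath product, regarded as a subgroup of $\mathrm{Hol}(A^\Omega)$, and define $$\varepsilon:W\to T,\qquad \varepsilon\big((r_x)_{x\in\Omega},u\big)=\Big(\prod_{x\in\Omega}\chi(r_x)\Big)u .$$ Then $\varepsilon$ is a surjective group homomorphism and $G=\ker\varepsilon$ is a regular subgroup of $\mathrm{Hol}(A^\Omega)$. Hence $G$ determines a finite skew brace, denoted $\mathsf{K}_T(C,\chi)$, satisfying $$(\mathsf{K}_T(C,\chi),+)\cong A^{|T|}\qquad\text{and}\qquad (\mathsf{K}_T(C,\chi),\circ)\cong G.$$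
   Context: A skew brace is a triple $(B,+,\circ)$ such that $(B,+)$ and $(B,\circ)$ are groups (neither assumed abelian) on the same set and $a\circ(b+c)=a\circ b-a+a\circ c$ for all $a,b,c\in B$. The two identity elements coincide. Its lambda map is the group homomorphism $\lambda^B:(B,\circ)\to\mathrm{Aut}(B,+)$, $\lambda^B_a(b)=-a+a\circ b$. For a group $H$, $\mathrm{Hol}(H)=H\rtimes\mathrm{Aut}(H)$ acts on $H$ by $(x,f)\cdot h=x\,f(h)$. A subgroup $G\le\mathrm{Hol}(H)$ is regular if its action on $H$ is transitive and free. A regular subgroup $G\le \mathrm{Hol}(H)$ determines a skew brace on the set $H$ whose additive group is $H$ and whose multiplicative group is obtained by transporting the group structure of $G$ along the bijection $G\to H$, $g\mapsto g\cdot e$, where $e$ is the identity of $H$. Notation: $\pi:R\to A$ is the identity map on the underlying set of $C$, so $\pi(rs)=\pi(r)+\lambda^C_r(\pi(s))$. The group $T$ acts on $R^\Omega=\prod_{x\in\Omega}R$ by ${}^u(r_x)_{x\in\Omega}=(r_{u^{-1}x})_{x\in\Omega}$, and $W=R^\Omega\rtimes T$ is the corresponding semidirect product, with $(r,u)(s,v)=(r\,{}^us,uv)$. The group $W$ acts on $A^\Omega$ by $$(r,u)\cdot(a_x)_{x\in\Omega}=\big(\pi(r_x)+\lambda^C_{r_x}(a_{u^{-1}x})\big)_{x\in\Omega},$$ and is regarded as a subgroup of $\mathrm{Hol}(A^\Omega)$ via the injective homomorphism $(r,u)\mapsto\big((\pi(r_x))_{x\in\Omega},\alpha_{(r,u)}\big)$,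 where $\alpha_{(r,u)}((a_x)_x)=(\lambda^C_{r_x}(a_{u^{-1}x}))_x$. *)

(* Defs.v *)
From HB Require Import structures.
From mathcomp Require Import all_boot.
From mathcomp Require Import all_fingroup.

Set Implicit Arguments.
Unset Strict Implicit.
Unset Printing Implicit Defensive.

Local Open Scope group_scope.

Reserved Notation "a \circ b" (at level 40, left associativity).

HB.instance Definition _ (aT : finType) (gT : finGroupType) :=
  Group.on {ffun aT -> gT}.

(* The additive group (B, +) of a skew brace is the ambient finGroupType
   structure of B. It is not assumed abelian, hence is written with the
   multiplicative notation of group_scope: x * y stands for x + y,
   x^-1 for - x, and 1 for the common identity element. *)
HB.mixin Record FinGroup_isSkewBrace B of FinGroup B := {
  circ : B -> B -> B;
  circ_one : B;
  circ_inv : B -> B;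
  circA : associative circ;
  circ1b : left_id circ_one circ;
  circVb : left_inverse circ_one circ_inv circ;
  circD : forall a b c : B, circ a (b * c) = circ a b * a^-1 * circ a c
}.

#[short(type="finSkewBraceType")]
HB.structure Definition FinSkewBrace :=
  {B of FinGroup_isSkewBrace B & FinGroup B}.

Notation "a \circ b" := (circ a b) : group_scope.

(* The multiplicative group (B, \circ), carried by an alias of B. *)
Definition circ_group (B : finSkewBraceType) : Type := B.
HB.instance Definition _ (B : finSkewBraceType) := Finite.on (circ_group B).
HB.instance Definition _ (B : finSkewBraceType) :=
  Finite_isGroup.Build (circ_group B) (@circA B) (@circ1b B) (@circVb B).

Definition pi (B : finSkewBraceType) (r : circ_group B) : B := r.

Definition lambda (B : finSkewBraceType) (a : circ_group B) (b : B) : B :=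
  (pi a)^-1 * (pi a \circ b).

Section Lambda.
Variable B : finSkewBraceType.
Implicit Types (a r s : circ_group B) (b c : B).

Lemma circ_b1 a : pi a \circ 1 = pi a.
Proof.
have := circD (pi a) 1 1; rewrite mulg1 -{1}[_ \circ 1]mulg1 -mulgA.
move=> /mulgI/(congr1 (mulg (pi a))).
by rewrite mulg1 mulKVg => /esym.
Qed.

Lemma circ_group1E : pi (1 : circ_group B) = 1.
Proof. by rewrite -circ_b1; exact: (@circ1b B 1). Qed.

Lemma piM r s : pi (r * s) = pi r * lambda r (pi s).
Proof. by rewrite /lambda mulKVg. Qed.

Lemma lambdaM a : {morph lambda a : b c / b * c}.
Proof. by move=> b c; rewrite /lambda circD !mulgA. Qed.

Lemma lambda1 b : lambda 1 b = b.
Proof.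
rewrite /lambda circ_group1E invg1 mul1g -circ_group1E; exact: (@circ1b B b).
Qed.

Lemma lambda_circ r s b : lambda (r * s) b = lambda r (lambda s b).
Proof.
have lamE a c : pi a * lambda a c = pi a \circ c by rewrite mulKVg.
apply: (mulgI (pi (r * s))); rewrite lamE piM -mulgA -lambdaM !lamE.
by symmetry; exact: (@circA B).
Qed.

Lemma lambdaK r : cancel (lambda r) (lambda r^-1).
Proof. by move=> b; rewrite -lambda_circ mulVg lambda1. Qed.

Lemma lambdaVK r : cancel (lambda r^-1) (lambda r).
Proof. by move=> b; rewrite -lambda_circ mulgV lambda1. Qed.
End Lambda.

(* Pairs (x, f) with x : H and f an automorphism of H. Automorphisms are
   composed as functions, (f g)(h) = f (g h), whereas the product of
   permutations in the library is g * f = f \o g; hence the swap in hol_mul. *)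
Record hol (H : finGroupType) := Hol {
  hol_val : H * {perm H};
  hol_valP : hol_val.2 \in Aut [set: H]
}.
HB.instance Definition _ (H : finGroupType) := [isSub for @hol_val H].
HB.instance Definition _ (H : finGroupType) := [Finite of hol H by <:].

Section Holomorph.
Variable H : finGroupType.
Implicit Types (g k : hol H) (x y h : H).

Definition hol_trans g : H := (hol_val g).1.
Definition hol_aut g : {perm H} := (hol_val g).2.

Lemma hol_autM g : {morph hol_aut g : x y / x * y}.
Proof.
have /morphicP fM := Aut_morphic (hol_valP g).
by move=> x y; apply: fM; rewrite inE.
Qed.

Lemma hol_aut1 g : hol_aut g 1 = 1.
Proof. by apply: (mulgI (hol_aut g 1)); rewrite -hol_autM !mulg1. Qed.

Lemma hol_autV g x : hol_aut g x^-1 = (hol_aut g x)^-1.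
Proof. by apply: (mulgI (hol_aut g x)); rewrite -hol_autM !mulgV hol_aut1. Qed.

Definition hol_mul g k : hol H :=
  Hol (hol_val := (hol_trans g * hol_aut g (hol_trans k), hol_aut k * hol_aut g))
      (groupM (hol_valP k) (hol_valP g)).

Definition hol_one : hol H := Hol (hol_val := (1, 1)) (group1 (Aut [set: H])).

Definition hol_inv g : hol H :=
  Hol (hol_val := ((hol_aut g)^-1 (hol_trans g)^-1, (hol_aut g)^-1))
      (groupVr (hol_valP g)).

Lemma hol_eq g k :
  hol_trans g = hol_trans k -> hol_aut g =1 hol_aut k -> g = k.
Proof.
move=> e1 e2; apply: val_inj; rewrite /= [hol_val g]surjective_pairing.
rewrite [hol_val k]surjective_pairing; congr pair; [exact: e1 | exact/permP].
Qed.

Lemma hol_mulA : associative hol_mul.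
Proof.
move=> g k l; apply: hol_eq => [|x]; last by rewrite /hol_aut /= !permM.
by rewrite /hol_trans /= hol_autM {3}/hol_aut /= permM !mulgA.
Qed.

Lemma hol_mul1 : left_id hol_one hol_mul.
Proof.
move=> g; apply: hol_eq => [|x]; last by rewrite {1}/hol_aut /= permM perm1.
by rewrite {1}/hol_trans /= mul1g perm1.
Qed.

Lemma hol_mulV : left_inverse hol_one hol_inv hol_mul.
Proof.
move=> g; apply: hol_eq => [|x]; last by rewrite /hol_aut /= mulgV.
have /= E := hol_autM (hol_inv g) (hol_trans g)^-1 (hol_trans g).
by rewrite {1}/hol_trans /= -E mulVg (hol_aut1 (hol_inv g)).
Qed.

HB.instance Definition _ := Finite_isGroup.Build (hol H) hol_mulA hol_mul1 hol_mulV.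

Definition hol_act g h : H := hol_trans g * hol_aut g h.

Lemma hol_act1 h : hol_act 1 h = h.
Proof. by rewrite /hol_act /= /hol_trans /= mul1g perm1. Qed.

Lemma hol_actM g k h : hol_act (g * k) h = hol_act g (hol_act k h).
Proof. by rewrite /hol_act hol_autM mulgA {2}/hol_aut /= permM. Qed.

Lemma hol_act_mul g x y : hol_act g (x * y) = hol_act g x * (hol_act g 1)^-1 * hol_act g y.
Proof. by rewrite /hol_act hol_aut1 mulg1 hol_autM -!mulgA mulKg. Qed.

Definition regular_subgroup (G : {set hol H}) : Prop :=
  [/\ group_set G,
      forall x y, exists2 g, g \in G & hol_act g x = y
    & forall g x, g \in G -> hol_act g x = x -> g = 1].

End Holomorph.

Section RegularBrace.
Variables (H : finGroupType) (G : {set hol H}) (regG : regular_subgroup G).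

(* The inverse of the bijection g |-> hol_act g 1 from G to H. *)
Definition regular_elt (x : H) : hol H :=
  odflt 1 [pick g in G | hol_act g 1 == x].

Lemma regular_eltP x : regular_elt x \in G /\ hol_act (regular_elt x) 1 = x.
Proof.
rewrite /regular_elt; case: pickP => [g /andP[Gg /eqP] //|no_g].
have [_ trG _] := regG; have [g Gg gx] := trG 1 x.
by have /andP[] := negbT (no_g g); rewrite Gg gx eqxx.
Qed.

Lemma regular_eltK g : g \in G -> regular_elt (hol_act g 1) = g.
Proof.
move=> Gg; have [grpG _ freeG] := regG; pose GG := Group grpG.
have [Gk kE] := regular_eltP (hol_act g 1); apply/eqP; rewrite eq_mulgV1.
rewrite -(conjg_eq1 _ g) /conjg mulgKV; apply/eqP.
apply: (freeG _ 1); first by rewrite (@groupM _ GG) ?(@groupVr _ GG).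
by rewrite hol_actM kE -hol_actM mulVg hol_act1.
Qed.

Definition regular_brace of regular_subgroup G : Type := H.
Local Notation K := (regular_brace regG).
HB.instance Definition _ := FinGroup.on K.

Definition regular_circ (x y : K) : K :=
  hol_act (regular_elt x * regular_elt y) 1.

Definition regular_circ_one : K := hol_act (1 : hol H) 1.

Definition regular_circ_inv (x : K) : K := hol_act (regular_elt x)^-1 1.

Lemma regular_circE (x y : K) : regular_circ x y = hol_act (regular_elt x) y.
Proof. by rewrite /regular_circ hol_actM (regular_eltP y).2. Qed.

Lemma regular_circ_transport g k : g \in G -> k \in G ->
  regular_circ (hol_act g 1) (hol_act k 1) = hol_act (g * k) 1.
Proof. by move=> Gg Gk; rewrite /regular_circ !regular_eltK. Qed.

Lemma regular_circA : associative regular_circ.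
Proof.
move=> x y z; rewrite 2!(regular_circE _ z) (regular_circE x).
rewrite /regular_circ regular_eltK ?hol_actM //.
have [grpG _ _] := regG; pose GG := Group grpG.
exact: (@groupM _ GG _ _ (regular_eltP x).1 (regular_eltP y).1).
Qed.

Lemma regular_circ1 : left_id regular_circ_one regular_circ.
Proof.
move=> x; have [grpG _ _] := regG; pose GG := Group grpG.
by rewrite regular_circE /regular_circ_one regular_eltK ?hol_act1 ?(@group1 _ GG).
Qed.

Lemma regular_circV : left_inverse regular_circ_one regular_circ_inv regular_circ.
Proof.
move=> x; have [grpG _ _] := regG; pose GG := Group grpG.
rewrite regular_circE /regular_circ_inv regular_eltK; last first.
  by rewrite (@groupVr _ GG) ?(regular_eltP x).1.
by rewrite -{2}(regular_eltP x).2 -hol_actM mulVg.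
Qed.

Lemma regular_circD (a b c : K) :
  regular_circ a (b * c) = regular_circ a b * a^-1 * regular_circ a c.
Proof. by rewrite !regular_circE hol_act_mul (regular_eltP a).2. Qed.

HB.instance Definition _ := FinGroup_isSkewBrace.Build K
  regular_circA regular_circ1 regular_circV regular_circD.

End RegularBrace.

(* The semidirect product R^T \rtimes T for the regular action of T on its
   underlying set. *)
Record wreath (R T : finGroupType) := Wreath {wr_val : {ffun T -> R} * T}.
HB.instance Definition _ (R T : finGroupType) := [isNew for @wr_val R T].
HB.instance Definition _ (R T : finGroupType) := [Finite of wreath R T by <:].

Section WreathProduct.
Variables R T : finGroupType.
Implicit Types (w : wreath R T) (r : {ffun T -> R}).

Definition wr_base w : {ffun T -> R} := (wr_val w).1.
Definition wr_top w : T := (wr_val w).2.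

Definition wr_shift (u : T) r : {ffun T -> R} := [ffun x => r (u^-1 * x)].

Definition wr_mul w1 w2 : wreath R T :=
  Wreath (wr_base w1 * wr_shift (wr_top w1) (wr_base w2), wr_top w1 * wr_top w2).

Definition wr_one : wreath R T := Wreath (1, 1).

Definition wr_inv w : wreath R T :=
  Wreath (wr_shift (wr_top w)^-1 (wr_base w)^-1, (wr_top w)^-1).

Lemma wr_eq w1 w2 :
  wr_base w1 =1 wr_base w2 -> wr_top w1 = wr_top w2 -> w1 = w2.
Proof.
case: w1 w2 => [[r u]] [[s v]]; rewrite /wr_base /wr_top /= => e1 e2.
by rewrite e2; congr (Wreath (_, _)); apply/ffunP.
Qed.

Lemma wr_mulA : associative wr_mul.
Proof.
move=> w1 w2 w3; apply: wr_eq => [x|]; last by rewrite /wr_top /= mulgA.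
by rewrite /wr_base /wr_top /= !ffunE invMg -!mulgA.
Qed.

Lemma wr_mul1 : left_id wr_one wr_mul.
Proof.
move=> w; apply: wr_eq => [x|]; last by rewrite {1}/wr_top /= mul1g.
by rewrite {1}/wr_base /wr_top /= !ffunE invg1 !mul1g.
Qed.

Lemma wr_mulV : left_inverse wr_one wr_inv wr_mul.
Proof.
move=> w; apply: wr_eq => [x|]; last by rewrite /wr_top /= mulVg.
by rewrite /wr_base /wr_top /= !ffunE mulVg.
Qed.

HB.instance Definition _ := Finite_isGroup.Build (wreath R T) wr_mulA wr_mul1 wr_mulV.

End WreathProduct.

Section WreathHolomorph.
Variables (C : finSkewBraceType) (T : finGroupType).
Local Notation W := (wreath (circ_group C) T).
Local Notation AO := {ffun T -> C}.
Implicit Types (w : W) (a : AO).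

Definition wr_alpha w a : AO :=
  [ffun x => lambda (wr_base w x) (a ((wr_top w)^-1 * x))].

Lemma wr_alpha_inj w : injective (wr_alpha w).
Proof.
move=> a b /ffunP eq_ab; apply/ffunP=> x; have := eq_ab (wr_top w * x).
by rewrite !ffunE mulKg => /(can_inj (lambdaK _)).
Qed.

Lemma wr_alpha_aut w : perm (@wr_alpha_inj w) \in Aut [set: AO].
Proof.
rewrite inE; apply/andP; split; first by apply/subsetP=> a _; rewrite inE.
apply/morphicP=> a b _ _; apply/ffunP=> x.
by rewrite !permE !ffunE lambdaM.
Qed.

Definition wr_trans w : AO := [ffun x => pi (wr_base w x)].

Definition wr_hol w : hol AO :=
  Hol (hol_val := (wr_trans w, perm (@wr_alpha_inj w))) (wr_alpha_aut w).

Lemma wr_holE w a : hol_act (wr_hol w) a =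
  [ffun x => pi (wr_base w x) * lambda (wr_base w x) (a ((wr_top w)^-1 * x))].
Proof. by apply/ffunP=> x; rewrite ffunE permE !ffunE. Qed.

Lemma wr_holM : {morph wr_hol : w1 w2 / w1 * w2}.
Proof.
move=> w1 w2; apply: hol_eq => [|a]; apply/ffunP=> x.
  by rewrite /hol_trans /= !ffunE permE !ffunE piM.
by rewrite /hol_aut /= permM !permE !ffunE lambda_circ invMg mulgA.
Qed.

(* The element b separates the top components; it exists when C is not trivial. *)
Lemma wr_hol_inj (b : C) : b != 1 -> injective wr_hol.
Proof.
move=> b1 w1 w2 e; have eb x : wr_base w1 x = wr_base w2 x.
  have /ffunP/(_ x) := congr1 (@hol_trans _) e.
  by rewrite !ffunE.
apply: wr_eq => //; pose d : AO := [ffun x => if x == 1 then b else 1].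
have /permP/(_ d)/ffunP/(_ (wr_top w1)) := congr1 (@hol_aut _) e.
rewrite !permE !ffunE -eb mulVg eqxx => /(can_inj (lambdaK _)).
case: eqP => [/eqP|_ /eqP]; last by rewrite (negPf b1).
by rewrite -eq_invg_mul invgK => /eqP ->.
Qed.

End WreathHolomorph.

Section KernelBrace.
Variables (C : finSkewBraceType) (T : finGroupType).
Variable chi : {morphism [set: circ_group C] >-> T}.
Local Notation W := (wreath (circ_group C) T).

Definition eps (w : W) : T := (\prod_(x : T) chi (wr_base w x)) * wr_top w.

(* ker eps, as a subset of Hol(A^T). *)
Definition eps_ker : {set hol {ffun T -> C}} :=
  @wr_hol C T @: [set w : W | eps w == 1].

Definition kernel_brace (regG : regular_subgroup eps_ker) : finSkewBraceType :=
  regular_brace regG.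

End KernelBrace.

(* Main.v *)
Require Import Defs.
From HB Require Import structures.
From mathcomp Require Import all_boot all_fingroup.

Set Implicit Arguments.
Unset Strict Implicit.
Unset Printing Implicit Defensive.

(** In terms of the multiplicative group, the action of W on A^Omega reads
    [((r, u) . a)_x = r_x \circ a_{u^-1 x}].  Hence for given points a, b and
    given u there is exactly one r with [(r, u) . a = b], namely
    [r_x = b_x \circ a_{u^-1 x}^-1]; as T is abelian, the product of the
    [chi r_x] is then [(prod chi b_x) (prod chi a_x)^-1], which does not depend
    on u.  So [eps (r, u) = 1] holds for exactly one u, which is regularity. *)

Local Open Scope group_scope.

Section AbelianProducts.
Variables (I : finType) (T : finGroupType).
Hypothesis abT : abelian [set: T].
Implicit Types f g : I -> T.

Lemma abelian_setT_mulgC : commutative (@mulg T).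
Proof. by move=> x y; apply: (centsP abT); rewrite inE. Qed.

(** Since [T] is abelian, its law is a commutative monoid law, so products over [T] may be split and
    reindexed. *)
Let mulT : Monoid.com_law (1 : T) := HB.pack (@mulg T)
  (Monoid.isComLaw.Build T 1 (@mulg T) (@mulgA T) abelian_setT_mulgC (@mul1g T)).

Lemma abelian_prodM f g : \prod_x (f x * g x) = (\prod_x f x) * (\prod_x g x).
Proof. exact: (@big_split _ 1 mulT). Qed.

Lemma abelian_prodV f : \prod_x (f x)^-1 = (\prod_x f x)^-1.
Proof.
apply: (mulgI (\prod_x f x)); rewrite mulgV -abelian_prodM.
by apply: big1 => x _; rewrite mulgV.
Qed.

Lemma abelian_prod_reindex (h : I -> I) f :
  injective h -> \prod_x f (h x) = \prod_x f x.
Proof.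
by move=> h_inj; symmetry; exact: (@reindex_inj _ mulT 1 I h xpredT f h_inj).
Qed.

End AbelianProducts.

Section RegularBraceGroup.
Variables (H : finGroupType) (G : {set hol H}) (regG : regular_subgroup G).

Lemma regular_brace_circ_isog :
  [set: circ_group (regular_brace regG)] \isog G.
Proof.
have [grpG _ _] := regG.
have groupMG g k : g \in G -> k \in G -> g * k \in G.
  exact: (@groupM _ (Group grpG)).
pose e (x : circ_group (regular_brace regG)) : hol H := regular_elt G x.
have eG x : e x \in G by have [] := regular_eltP regG x.
have eK x : hol_act (e x) 1 = x by have [] := regular_eltP regG x.
have eM : {in [set: circ_group (regular_brace regG)] &, {morph e : x y / x * y}}.
  (* By definition [x \circ y] is [hol_act (e x * e y) 1]; freeness, through [regular_eltK],
     recovers [e x * e y] from this point. *)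
  by move=> x y _ _; apply: (regular_eltK regG (groupMG _ _ (eG x) (eG y))).
apply/(@isogP _ _ _ (Group grpG)); exists (Morphism eM).
  by apply/injmP => x y _ _ /= exy; rewrite -(eK x) exy eK.
rewrite morphimEdom; apply/setP=> g; apply/imsetP/idP => [[x _ ->] | Gg] //.
by exists (hol_act g 1); rewrite ?inE //= /e regular_eltK.
Qed.

End RegularBraceGroup.

Lemma ffun_isog_ord (I : finType) (gT : finGroupType) :
  [set: {ffun I -> gT}] \isog [set: {ffun 'I_#|I| -> gT}].
Proof.
pose f (a : {ffun I -> gT}) : {ffun 'I_#|I| -> gT} := [ffun i => a (enum_val i)].
have fM : {in [set: {ffun I -> gT}] &, {morph f : a b / a * b}}.
  by move=> a b _ _; apply/ffunP=> i; rewrite !ffunE.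
apply/isogP; exists (Morphism fM).
  apply/injmP => a b _ _ /= /ffunP eab; apply/ffunP=> x.
  by have := eab (enum_rank x); rewrite !ffunE enum_rankK.
rewrite morphimEdom; apply/setP=> b; rewrite inE; apply/imsetP.
exists [ffun x => b (enum_rank x)]; rewrite ?inE //=.
by apply/ffunP=> i; rewrite !ffunE enum_valK.
Qed.

Section KernelRegular.
Variables (C : finSkewBraceType) (T : finGroupType).
Hypothesis abT : abelian [set: T].
Variable chi : {morphism [set: circ_group C] >-> T}.
Local Notation R := (circ_group C).
Local Notation W := (wreath R T).
Local Notation AO := {ffun T -> C}.

Lemma eps_morph : {morph eps chi : w1 w2 / w1 * w2}.
Proof.
move=> w1 w2; rewrite /eps.
have -> : \prod_x chi (wr_base (w1 * w2) x)
    = \prod_x (chi (wr_base w1 x) * chi (wr_base w2 ((wr_top w1)^-1 * x))).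
  by apply: eq_bigr => x _; rewrite /wr_base /= !ffunE morphM ?inE.
rewrite abelian_prodM //.
(* The twist by the top component of [w1] only permutes the factors, so it leaves the product
   unchanged. *)
rewrite (abelian_prod_reindex abT (fun x => chi (wr_base w2 x)) (mulgI _)).
rewrite /wr_top /= -!mulgA; congr (_ * _).
by rewrite !mulgA (abelian_setT_mulgC abT (wr_val w1).2).
Qed.

Lemma eps_surj t : exists w, eps chi w = t.
Proof.
exists (Wreath (1, t)); rewrite /eps big1 ?mul1g // => x _.
by rewrite /wr_base /= ffunE morph1.
Qed.

(** Read in [R], where [*] is [\circ], the affine map given by [pi] and [lambda] is a left
    translation in each coordinate, so group cancellation applies. *)
Lemma wr_hol_actE (w : W) (a : AO) x :
  hol_act (wr_hol w) a x = wr_base w x * (a ((wr_top w)^-1 * x) : R) :> R.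
Proof. by rewrite wr_holE ffunE -piM. Qed.

Lemma wr_hol1 : wr_hol (1 : W) = 1.
Proof. by apply: (mulgI (wr_hol (1 : W))); rewrite -wr_holM !mulg1. Qed.

Lemma wr_base_act (w : W) (a b : AO) : hol_act (wr_hol w) a = b ->
  forall x, wr_base w x = (b x : R) * (a ((wr_top w)^-1 * x) : R)^-1.
Proof. by move=> <- x; rewrite wr_hol_actE mulgK. Qed.

(** Translation by [u^-1] permutes the index set, which removes [u] from the product. *)
Lemma prod_chi_quot (a b : AO) (u : T) :
  \prod_x chi ((b x : R) * (a (u^-1 * x) : R)^-1)
    = (\prod_x chi (b x : R)) * (\prod_x chi (a x : R))^-1.
Proof.
rewrite -(abelian_prod_reindex abT (fun x => chi (a x)) (mulgI u^-1)).
rewrite -abelian_prodV // -abelian_prodM //.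
by apply: eq_bigr => x _; rewrite morphM ?morphV ?inE.
Qed.

Lemma eps_ker_regular : regular_subgroup (eps_ker chi).
Proof.
split.
- apply/group_setP; split=> [|g k /imsetP[w1] + -> /imsetP[w2] + ->].
    apply/imsetP; exists 1; rewrite ?wr_hol1 // inE.
    by apply/eqP/(mulgI (eps chi 1)); rewrite -eps_morph !mulg1.
  rewrite !inE => /eqP e1 /eqP e2; apply/imsetP; exists (w1 * w2).
    by rewrite inE eps_morph e1 e2 mulg1.
  by rewrite wr_holM.
- move=> a b.
  (* The base [r] is forced by [wr_base_act], and [u] is then forced by [eps = 1]: it inverts the
     product of the [chi (r x)]. *)
  pose u := ((\prod_x chi (b x : R)) * (\prod_x chi (a x : R))^-1)^-1.
  pose r : {ffun T -> R} := [ffun x => (b x : R) * (a (u^-1 * x) : R)^-1].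
  exists (wr_hol (Wreath (r, u))).
    apply/imsetP; exists (Wreath (r, u)) => //; rewrite inE /eps /wr_base /wr_top /=.
    under eq_bigr => x _ do rewrite ffunE.
    by rewrite prod_chi_quot mulgV.
  by apply/ffunP=> x; rewrite wr_hol_actE /wr_base /wr_top /= ffunE mulgKV.
- move=> g a /imsetP[w + ->] /wr_base_act wE; rewrite inE /eps.
  under eq_bigr => x _ do rewrite wE.
  (* With [b = a] the two products cancel, so [eps chi w] is the top component of [w], which is
     therefore trivial; then each base coordinate is a quotient of equal elements. *)
  rewrite prod_chi_quot mulgV mul1g => /eqP u1.
  rewrite -wr_hol1; congr wr_hol; apply: wr_eq => // x.
  by rewrite wE u1 invg1 mul1g mulgV /wr_base /= ffunE.
Qed.

End KernelRegular.

Theorem theoremA (C : finSkewBraceType) (T : finGroupType)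
    (abT : abelian [set: T]) (ntT : [set: T] != 1)
    (chi : {morphism [set: circ_group C] >-> T})
    (chi_surj : forall t : T, exists r : circ_group C, chi r = t) :
  [/\ {morph eps chi : w1 w2 / w1 * w2 >-> w1 * w2},
      forall t : T, exists w, eps chi w = t
    & exists regG : regular_subgroup (eps_ker chi),
        [set: kernel_brace regG] \isog [set: {ffun 'I_#|T| -> C}]
        /\ [set: circ_group (kernel_brace regG)] \isog eps_ker chi].
Proof.
split; [exact: eps_morph | exact: eps_surj |].
exists (eps_ker_regular abT chi); split; last exact: regular_brace_circ_isog.
(* The additive group is [{ffun T -> C}] by construction; only the relabelling of [T] by ordinals
   remains. *)
exact: ffun_isog_ord.
Qed.
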